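(* Let $f(z)=\sum_{k=0}^\infty a_kz^k$ and $g(z)=\sum_{k=0}^\infty b_kz^k$ be two analytic functions in $\mathbb{D}$. If $f$ is quasi-subordinate to $g$ in $\mathbb{D}$, then $$\sum_{k=0}^\infty |a_k|\, r^k \le \sum_{k=0}^\infty |b_k|\, r^k \quad\text{for all } 0\le r\le \frac13 .$$
   Context: $\mathbb{D}=\{z\in\mathbb{C}: |z|<1\}$. For analytic functions $f,g$ in $\mathbb{D}$, $f$ is quasi-subordinate to $g$ (written $f(z)\prec_q g(z)$) if there exist two functions $\Phi$ and $\omega$, analytic in $\mathbb{D}$, with $\omega(0)=0$, $|\Phi(z)|\le 1$ and $|\omega(z)|\le 1$ for all $|z|<1$, such that $f(z)=\Phi(z)\,g(\omega(z))$ for all $z\in\mathbb{D}$. *)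

(* Defs.v *)
From Stdlib Require Import Reals.
From Coquelicot Require Import Coquelicot.
Open Scope R_scope.

Definition unit_disc (z : C) : Prop := Cmod z < 1.

Definition analytic_at (f : C -> C) (z0 : C) : Prop :=
  exists (c : nat -> C) (rho : R),
    0 < rho /\
    forall z : C, Cmod (z - z0)%C < rho ->
      @is_pseries C_AbsRing C_NormedModule c (z - z0)%C (f z).

Definition analytic_on (D : C -> Prop) (f : C -> C) : Prop :=
  forall z : C, D z -> analytic_at f z.

(* By the maximum principle, [omega 0 = 0] and [Cmod (omega z) <= 1] force
   [Cmod (omega z) < 1] in the disc, so the values of the total function [g]
   outside the disc play no role. *)
Definition quasi_subordinate (f g : C -> C) : Prop :=
  exists Phi omega : C -> C,
    analytic_on unit_disc Phi /\
    analytic_on unit_disc omega /\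
    omega (RtoC 0) = RtoC 0 /\
    (forall z : C, unit_disc z -> Cmod (Phi z) <= 1 /\ Cmod (omega z) <= 1) /\
    (forall z : C, unit_disc z -> f z = (Phi z * g (omega z))%C).

(* Main.v *)
(* Write [omega z = z * sigma z]; by Schwarz's lemma [sigma] is bounded by 1 on
   the disc, so every [F = Phi * sigma ^ k] is analytic and bounded by 1.  For such
   an [F] with Taylor coefficients [c], Wiener's inequality
   [|c n| <= 1 - |c 0| ^ 2] gives Bohr's inequality [sum |c n| r ^ n <= 1] for
   [r <= 1/3].  Since [f = sum_k b k * z ^ k * (Phi * sigma ^ k)], summing these
   majorants with weights [|b k| r ^ k] gives the claim.

   No Cauchy theory is used.  The only global analytic input, the maximum
   principle, follows from second-order Taylor expansions: at an interior maximum
   of [|F z| + e |z| ^ 2], averaging over [z + h], [z - h], [z + i h], [z - i h]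
   loses [O(|h| ^ 3)] but gains [e |h| ^ 2].  All coefficient identities hold at
   the level of finite Taylor expansions at the origin. *)
Require Import Defs.
From Stdlib Require Import Reals Lra Lia Classical ClassicalEpsilon List.
From Coquelicot Require Import Coquelicot.
Open Scope R_scope.

(** * Properties holding near the origin *)

Definition near0 (P : C -> Prop) : Prop :=
  exists d : R, 0 < d /\ forall h : C, Cmod h < d -> P h.

Lemma near0_and (P Q : C -> Prop) :
  near0 P -> near0 Q -> near0 (fun h => P h /\ Q h).
Proof.
  intros [d [Hd HP]] [e [He HQ]].
  exists (Rmin d e); split; [now apply Rmin_glb_lt|].
  intros h Hh; split.
  - apply HP; eapply Rlt_le_trans; [exact Hh|apply Rmin_l].
  - apply HQ; eapply Rlt_le_trans; [exact Hh|apply Rmin_r].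
Qed.

Lemma near0_imp (P Q : C -> Prop) :
  (forall h, P h -> Q h) -> near0 P -> near0 Q.
Proof. intros H [d [Hd HP]]; exists d; split; auto. Qed.

Lemma near0_at (P : C -> Prop) : near0 P -> P (RtoC 0).
Proof. intros [d [Hd HP]]; apply HP; rewrite Cmod_0; exact Hd. Qed.

Lemma near0_ball (d : R) : 0 < d -> near0 (fun h => Cmod h < d).
Proof. intros Hd; exists d; auto. Qed.

Lemma near0_scale (w : C) (P : C -> Prop) :
  near0 P -> near0 (fun h => P (w * h)%C).
Proof.
  intros [d [Hd HP]].
  assert (Hw : 0 < Cmod w + 1) by (generalize (Cmod_ge_0 w); lra).
  exists (d / (Cmod w + 1)); split; [now apply Rdiv_lt_0_compat|].
  intros h Hh; apply HP; rewrite Cmod_mult.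
  apply Rle_lt_trans with ((Cmod w + 1) * Cmod h).
  - apply Rmult_le_compat_r; [apply Cmod_ge_0|lra].
  - replace d with ((Cmod w + 1) * (d / (Cmod w + 1))) by (field; lra).
    now apply Rmult_lt_compat_l.
Qed.

(** * Finite Taylor expansions at the origin and their algebra *)

Definition shift (c : nat -> C) (n : nat) : C := c (S n).

(* [jet N f c] says [f h = c 0 + c 1 h + ... + c (N-1) h^(N-1) + O(h^N)] at the
   origin, in nested (Horner) form, which turns all closure properties into
   inductions on [N] without any manipulation of truncated sums. *)
Fixpoint jet (N : nat) (f : C -> C) (c : nat -> C) {struct N} : Prop :=
  match N with
  | O => exists K : R, near0 (fun h => Cmod (f h) <= K)
  | S N => exists g : C -> C,
      near0 (fun h => f h = c O + h * g h)%C /\ jet N g (shift c)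
  end.

Lemma jet_ext (N : nat) : forall (f g : C -> C) (c d : nat -> C),
  near0 (fun h => f h = g h) -> (forall n, (n < N)%nat -> c n = d n) ->
  jet N f c -> jet N g d.
Proof.
  induction N as [|N IH]; intros f g c d Hfg Hcd; simpl.
  - intros [K HK]; exists K.
    generalize (near0_and _ _ Hfg HK); apply near0_imp.
    intros h [E H]; now rewrite <- E.
  - intros [k [Hk Jk]]; exists k; split.
    + generalize (near0_and _ _ Hfg Hk); apply near0_imp.
      intros h [E H]; rewrite <- E, H, (Hcd O); [reflexivity|lia].
    + apply (IH k k (shift c)); [|intros n Hn; apply Hcd; lia|exact Jk].
      exists 1; split; [lra|auto].
Qed.

Lemma jet_ext_fun (N : nat) (f g : C -> C) (c : nat -> C) :
  near0 (fun h => f h = g h) -> jet N f c -> jet N g c.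
Proof. intros H; apply jet_ext; auto. Qed.

Lemma jet_bounded (N : nat) : forall (f : C -> C) (c : nat -> C),
  jet N f c -> exists K : R, 0 < K /\ near0 (fun h => Cmod (f h) <= K).
Proof.
  induction N as [|N IH]; intros f c.
  - intros [K HK]; exists (Rabs K + 1); split; [generalize (Rabs_pos K); lra|].
    revert HK; apply near0_imp; intros h; generalize (Rle_abs K); lra.
  - intros [g [Hg Jg]]; destruct (IH _ _ Jg) as [K [HK0 HK]].
    exists (Cmod (c O) + K); split; [generalize (Cmod_ge_0 (c O)); lra|].
    generalize (near0_and _ _ (near0_and _ _ Hg HK) (near0_ball 1 Rlt_0_1)).
    apply near0_imp; intros h [[E H] H1]; rewrite E.
    eapply Rle_trans; [apply Cmod_triangle|]; rewrite Cmod_mult.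
    generalize (Cmod_ge_0 h) (Cmod_ge_0 (g h)); nra.
Qed.

Lemma jet_weaken (N : nat) : forall (f : C -> C) (c : nat -> C),
  jet (S N) f c -> jet N f c.
Proof.
  induction N as [|N IH]; intros f c Hf.
  - destruct (jet_bounded _ _ _ Hf) as [K [_ HK]]; now exists K.
  - destruct Hf as [g [Hg Jg]]; exists g; split; auto.
Qed.

Lemma jet_le (M N : nat) (f : C -> C) (c : nat -> C) :
  (M <= N)%nat -> jet N f c -> jet M f c.
Proof.
  induction 1 as [|N _ IH]; [auto|intros H; now apply IH, jet_weaken].
Qed.

Lemma jet_value (N : nat) (f : C -> C) (c : nat -> C) :
  jet (S N) f c -> f (RtoC 0) = c O.
Proof. intros [g [Hg _]]; apply near0_at in Hg; rewrite Hg; ring. Qed.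

(* Agreement is required only off [0], so that the induction can divide by [h]. *)
Lemma jet_unique (N : nat) : forall (f g : C -> C) (c d : nat -> C),
  near0 (fun h => h <> RtoC 0 -> f h = g h) -> jet N f c -> jet N g d ->
  forall n, (n < N)%nat -> c n = d n.
Proof.
  induction N as [|N IH]; intros f g c d Hfg Jf Jg n Hn; [lia|].
  destruct Jf as [f1 [Ef Jf]]; destruct Jg as [g1 [Eg Jg]].
  destruct (jet_bounded _ _ _ Jf) as [K [HK Bf]].
  destruct (jet_bounded _ _ _ Jg) as [L [HL Bg]].
  assert (E0 : c O = d O).
  { destruct (Ceq_dec (c O) (d O)) as [E|E]; [exact E|exfalso].
    assert (Hpos : 0 < Cmod (c O - d O)%C).
    { apply Cmod_gt_0; intros H; apply E.
      replace (c O) with (c O - d O + d O)%C by ring; rewrite H; ring. }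
    destruct (near0_and _ _ (near0_and _ _ (near0_and _ _ Ef Eg)
      (near0_and _ _ Bf Bg)) Hfg) as [e [He H]].
    (* At a real point [t] the two expansions give |c 0 - d 0| <= t (K + L), whereas this choice of
       [t] forces 2 t (K + L) <= |c 0 - d 0|. *)
    set (t := Rmin (e / 2) (Cmod (c O - d O)%C / (2 * (K + L)))).
    assert (Ht : 0 < t).
    { apply Rmin_glb_lt; [lra|apply Rdiv_lt_0_compat; lra]. }
    assert (Hmt : Cmod (RtoC t) = t) by (rewrite Cmod_R; apply Rabs_pos_eq; lra).
    assert (Hte : t <= e / 2) by apply Rmin_l.
    destruct (H (RtoC t)) as [[[H1 H2] [H3 H4]] H5]; [rewrite Hmt; lra|].
    assert (H6 : RtoC t <> RtoC 0).
    { intros Z; apply RtoC_inj in Z; lra. }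
    specialize (H5 H6); rewrite H1, H2 in H5.
    assert (H7 : (c O - d O)%C = (RtoC t * (g1 (RtoC t) - f1 (RtoC t)))%C).
    { transitivity (c O + RtoC t * f1 (RtoC t) - d O - RtoC t * f1 (RtoC t))%C;
        [ring|rewrite H5; ring]. }
    assert (H8 : Cmod (c O - d O)%C <= t * (L + K)).
    { rewrite H7, Cmod_mult, Hmt; apply Rmult_le_compat_l; [lra|].
      unfold Cminus; eapply Rle_trans; [apply Cmod_triangle|].
      rewrite Cmod_opp; lra. }
    assert (H9 : t * (2 * (K + L)) <= Cmod (c O - d O)%C).
    { apply Rle_trans with
        (Cmod (c O - d O)%C / (2 * (K + L)) * (2 * (K + L))).
      - apply Rmult_le_compat_r; [lra|apply Rmin_r].
      - right; field; lra. }
    nra. }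
  destruct n as [|n]; [exact E0|].
  apply (IH f1 g1 (shift c) (shift d)); [|exact Jf|exact Jg|lia].
  generalize (near0_and _ _ Hfg (near0_and _ _ Ef Eg)).
  apply near0_imp; intros h [H [H1 H2]] Hh.
  specialize (H Hh); rewrite H1, H2, E0 in H.
  assert (H3 : (h * f1 h)%C = (h * g1 h)%C).
  { transitivity (d O + h * f1 h - d O)%C; [ring|rewrite H; ring]. }
  transitivity (/ h * (h * f1 h))%C; [field; exact Hh|].
  rewrite H3; field; exact Hh.
Qed.

Definition const_seq (x : C) (n : nat) : C :=
  match n with O => x | S _ => RtoC 0 end.

Lemma jet_zero (N : nat) : jet N (fun _ => RtoC 0) (fun _ => RtoC 0).
Proof.
  induction N as [|N IH].
  - exists 0; exists 1; split; [lra|intros; rewrite Cmod_0; lra].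
  - exists (fun _ => RtoC 0); split; [|exact IH].
    exists 1; split; [lra|intros; ring].
Qed.

Lemma jet_const (N : nat) (x : C) : jet N (fun _ => x) (const_seq x).
Proof.
  destruct N as [|N].
  - exists (Cmod x); exists 1; split; [lra|intros; lra].
  - exists (fun _ => RtoC 0); split; [|exact (jet_zero N)].
    exists 1; split; [lra|intros; simpl; ring].
Qed.

Lemma jet_plus (N : nat) : forall (f g : C -> C) (c d : nat -> C),
  jet N f c -> jet N g d ->
  jet N (fun h => f h + g h)%C (fun n => c n + d n)%C.
Proof.
  induction N as [|N IH]; intros f g c d.
  - intros [K HK] [L HL]; exists (K + L).
    generalize (near0_and _ _ HK HL); apply near0_imp; intros h [H1 H2].
    eapply Rle_trans; [apply Cmod_triangle|lra].
  - intros [f1 [E1 J1]] [g1 [E2 J2]].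
    exists (fun h => f1 h + g1 h)%C; split; [|exact (IH _ _ _ _ J1 J2)].
    generalize (near0_and _ _ E1 E2); apply near0_imp; intros h [-> ->]; ring.
Qed.

Lemma jet_smult (N : nat) (x : C) : forall (f : C -> C) (c : nat -> C),
  jet N f c -> jet N (fun h => x * f h)%C (fun n => x * c n)%C.
Proof.
  induction N as [|N IH]; intros f c.
  - intros [K HK]; exists (Cmod x * K); revert HK; apply near0_imp; intros h H.
    rewrite Cmod_mult; apply Rmult_le_compat_l; [apply Cmod_ge_0|exact H].
  - intros [g [E J]]; exists (fun h => x * g h)%C; split; [|exact (IH _ _ J)].
    revert E; apply near0_imp; intros h ->; ring.
Qed.

(** The Cauchy product, computed by peeling off the first coefficient of the left factor so that it
    follows the Horner form of [jet]. *)
Fixpoint conv (c d : nat -> C) (n : nat) {struct n} : C :=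
  match n with
  | O => (c O * d O)%C
  | S n => (c O * d (S n) + conv (shift c) d n)%C
  end.

(** With f = c 0 + h f1 and g = d 0 + h g1, the product is c 0 d 0 + h (c 0 g1 + f1 g). Leaving [g]
    whole in the last term matches the recursion of [conv]. *)
Lemma jet_mult (N : nat) : forall (f g : C -> C) (c d : nat -> C),
  jet N f c -> jet N g d -> jet N (fun h => f h * g h)%C (conv c d).
Proof.
  induction N as [|N IH]; intros f g c d.
  - intros Jf Jg.
    destruct (jet_bounded _ _ _ Jf) as [K [HK Bf]].
    destruct (jet_bounded _ _ _ Jg) as [L [HL Bg]].
    exists (K * L); generalize (near0_and _ _ Bf Bg); apply near0_imp.
    intros h [H1 H2]; rewrite Cmod_mult.
    apply Rmult_le_compat; auto using Cmod_ge_0.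
  - intros [f1 [E1 J1]] Jg; generalize Jg; intros [g1 [E2 J2]].
    exists (fun h => c O * g1 h + f1 h * g h)%C; split.
    + generalize (near0_and _ _ E1 E2); apply near0_imp; intros h [-> ->].
      simpl; ring.
    + apply (jet_plus N (fun h => c O * g1 h)%C (fun h => f1 h * g h)%C
        (fun n => c O * d (S n))%C (conv (shift c) d)).
      * exact (jet_smult N (c O) _ _ J2).
      * exact (IH _ _ _ _ J1 (jet_weaken _ _ _ Jg)).
Qed.

(** Writing f = c 0 + h g gives 1/f = 1/c 0 - (h/c 0) (g/f), so an expansion of 1/f to order [M]
    yields one to order [S M]. The start is the bound |f| >= |c 0|/2 near the origin; since [g] is
    expanded to order [N], the process reaches [S N]. *)
Lemma jet_inv (N : nat) : forall (f : C -> C) (c : nat -> C),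
  c O <> RtoC 0 -> jet (S N) f c -> exists d, jet (S N) (fun h => / f h)%C d.
Proof.
  intros f c Hc [g [E J]].
  assert (HB : near0 (fun h => Cmod (c O) / 2 <= Cmod (f h))).
  { destruct (jet_bounded _ _ _ J) as [K [HK B]].
    assert (Hp : 0 < Cmod (c O)) by now apply Cmod_gt_0.
    generalize (near0_and _ _ (near0_and _ _ E B)
      (near0_ball (Cmod (c O) / (2 * K))
        ltac:(apply Rdiv_lt_0_compat; lra))).
    apply near0_imp; intros h [[-> H1] H2].
    assert (H3 : Cmod (h * g h)%C <= Cmod (c O) / 2).
    { rewrite Cmod_mult.
      replace (Cmod (c O) / 2) with (Cmod (c O) / (2 * K) * K) by (field; lra).
      apply Rmult_le_compat; auto using Cmod_ge_0; lra. }
    assert (H4 : Cmod (c O) <= Cmod (c O + h * g h)%C + Cmod (h * g h)%C).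
    { rewrite <- (Cmod_opp (h * g h)%C).
      eapply Rle_trans; [|apply Cmod_triangle]; right; f_equal; ring. }
    lra. }
  assert (HB0 : near0 (fun h => f h <> RtoC 0)).
  { revert HB; apply near0_imp; intros h H Z; rewrite Z, Cmod_0 in H.
    apply Cmod_gt_0 in Hc; lra. }
  assert (Estep : near0 (fun h => / f h = / c O + h * (- / c O * (g h * / f h)))%C).
  { generalize (near0_and _ _ E HB0); apply near0_imp; intros h [H1 H2].
    transitivity (/ c O * ((f h - h * g h) * / f h))%C.
    - replace (f h - h * g h)%C with (c O) by (rewrite H1; ring).
      field; auto.
    - field; auto. }
  assert (H : forall M, (M <= S N)%nat ->
    exists d, jet M (fun h => / f h)%C d).
  { induction M as [|M IH]; intros HM.
    - exists (fun _ => RtoC 0); exists (/ (Cmod (c O) / 2)).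
      generalize (near0_and _ _ HB HB0); apply near0_imp; intros h [H1 H2].
      apply Cmod_gt_0 in Hc.
      rewrite Cmod_inv by exact H2; apply Rinv_le_contravar; lra.
    - destruct IH as [d Hd]; [lia|].
      exists (fun n => match n with
        | O => / c O
        | S n => - / c O * conv (shift c) d n end)%C.
      exists (fun h => - / c O * (g h * / f h))%C; split; [exact Estep|].
      apply (jet_smult M (- / c O)%C (fun h => g h * / f h)%C
        (conv (shift c) d)).
      apply jet_mult; [|exact Hd].
      apply (jet_le M N); [lia|exact J]. }
  now apply H.
Qed.

Lemma jet_scale (N : nat) (w : C) : forall (f : C -> C) (c : nat -> C),
  jet N f c -> jet N (fun h => f (w * h)%C) (fun n => w ^ n * c n)%C.
Proof.
  induction N as [|N IH]; intros f c.
  - intros [K HK]; exists K; exact (near0_scale w _ HK).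
  - intros [g [E J]]; exists (fun h => w * g (w * h))%C; split.
    + apply (near0_scale w) in E; revert E; apply near0_imp; intros h ->.
      simpl; ring.
    + apply IH in J; apply (jet_smult N w) in J.
      eapply jet_ext; [| |exact J]; [exists 1; split; [lra|reflexivity]|].
      intros n _; unfold shift; rewrite Cpow_S; ring.
Qed.

Lemma jet_id (N : nat) (z : C) : exists c, jet N (fun h => z + h)%C c.
Proof.
  destruct N as [|N].
  - exists (fun _ => RtoC 0), (Cmod z + 1), 1; split; [lra|intros h Hh].
    eapply Rle_trans; [apply Cmod_triangle|lra].
  - exists (fun n => match n with O => z | S n => const_seq (RtoC 1) n end).
    exists (fun _ => RtoC 1); split; [|exact (jet_const N (RtoC 1))].
    exists 1; split; [lra|intros; ring].
Qed.

(** The quotient f(h)/h^n, with the value [x] filling the removable singularity at 0; [x] will be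
    the [n]-th coefficient. *)
Definition div_pow (n : nat) (f : C -> C) (x h : C) : C :=
  if Ceq_dec h (RtoC 0) then x else (f h / h ^ n)%C.

(** Each division by [h] costs one order. At least one order has to survive, because the base case
    reads the value at the origin off the expansion. *)
Lemma jet_div_pow (n M : nat) : forall (f : C -> C) (c : nat -> C),
  (forall k, (k < n)%nat -> c k = RtoC 0) -> jet (n + S M) f c ->
  jet (S M) (div_pow n f (c n)) (fun k => c (n + k)%nat).
Proof.
  induction n as [|n IH]; intros f c Hc J.
  - refine (jet_ext_fun _ _ _ _ _ J).
    assert (H0 := jet_value _ _ _ J).
    exists 1; split; [lra|intros h _]; unfold div_pow.
    destruct (Ceq_dec h (RtoC 0)) as [->|Hh]; [exact H0|].
    simpl; field.
  - destruct J as [g [E J]].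
    refine (jet_ext_fun _ _ _ _ _ (IH g (shift c) _ J)).
    + revert E; apply near0_imp; intros h E; unfold div_pow.
      destruct (Ceq_dec h (RtoC 0)) as [Z|Hh]; [reflexivity|].
      rewrite E, (Hc O) by lia; rewrite Cpow_S; field.
      split; [now apply Cpow_nz|exact Hh].
    + intros k Hk; apply Hc; lia.
Qed.

(** * From convergent power series to finite expansions *)

Lemma pow_n_Cpow (z : C) (n : nat) : @pow_n C_AbsRing z n = (z ^ n)%C.
Proof. induction n as [|n IH]; simpl; [reflexivity|now rewrite IH]. Qed.

(** Partial sums of a convergent series are bounded, and each term is a difference of two
    consecutive partial sums. *)
Lemma pseries_coeff_bound (c : nat -> C) (z l : C) :
  @is_pseries C_AbsRing C_NormedModule c z l ->
  exists M : R, forall n, Cmod (c n) * Cmod z ^ n <= M.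
Proof.
  intros H.
  destruct (@filterlim_bounded C_AbsRing C_NormedModule
    (sum_n (fun k => scal (@pow_n C_AbsRing z k) (c k)))) as [M HM].
  { exists l; exact H. }
  assert (HM' : forall n, Cmod (sum_n (fun k => z ^ k * c k)%C n) <= M).
  { intros n; specialize (HM n).
    rewrite (sum_n_ext _ (fun k => z ^ k * c k)%C) in HM; [exact HM|].
    intros k; rewrite pow_n_Cpow; reflexivity. }
  exists (2 * M); intros n.
  replace (Cmod (c n) * Cmod z ^ n) with (Cmod (z ^ n * c n)%C)
    by (rewrite Cmod_mult, Cmod_pow; ring).
  destruct n as [|n].
  - specialize (HM' O); rewrite sum_O in HM'.
    generalize (Cmod_ge_0 (z ^ 0 * c O)%C); lra.
  - replace (z ^ S n * c (S n))%C with
      (sum_n (fun k => z ^ k * c k)%C (S n)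
        + - sum_n (fun k => z ^ k * c k)%C n)%C.
    + eapply Rle_trans; [apply Cmod_triangle|].
      rewrite Cmod_opp; generalize (HM' n) (HM' (S n)); lra.
    + rewrite sum_Sn; change plus with Cplus; ring.
Qed.

(** The terms are bounded by [M] at radius rho/2, so for |h| < rho/4 they are dominated by M/2^n and
    all partial sums by 2 M. A partial sum within distance 1 of the limit then gives the bound 2 M +
    1. *)
Lemma pseries_bounded (c : nat -> C) (f : C -> C) (rho : R) :
  0 < rho ->
  (forall h, Cmod h < rho -> @is_pseries C_AbsRing C_NormedModule c h (f h)) ->
  exists K : R, near0 (fun h => Cmod (f h) <= K).
Proof.
  intros Hrho H.
  assert (Hm : Cmod (RtoC (rho / 2)) = rho / 2)
    by (rewrite Cmod_R; apply Rabs_pos_eq; lra).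
  destruct (pseries_coeff_bound c (RtoC (rho / 2)) _ (H (RtoC (rho / 2)) ltac:(rewrite Hm; lra)))
    as [M HM].
  rewrite Hm in HM.
  assert (HM0 : 0 <= M).
  { specialize (HM O); simpl in HM; generalize (Cmod_ge_0 (c O)); lra. }
  exists (2 * M + 1), (rho / 4); split; [lra|]; intros h Hh.
  assert (HS : forall n, Cmod (sum_n (fun k => scal (@pow_n C_AbsRing h k) (c k) : C) n)
    <= 2 * M - M * (1 / 2) ^ n).
  { assert (Ht : forall n, Cmod (h ^ n * c n)%C <= M * (1 / 2) ^ n).
    { intros n; rewrite Cmod_mult, Cmod_pow.
      apply Rle_trans with ((rho / 4) ^ n * Cmod (c n)).
      - apply Rmult_le_compat_r; [apply Cmod_ge_0|].
        apply pow_incr; split; [apply Cmod_ge_0|lra].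
      - replace (rho / 4) with (rho / 2 * (1 / 2)) by field.
        rewrite Rpow_mult_distr.
        replace ((rho / 2) ^ n * (1 / 2) ^ n * Cmod (c n))
          with (Cmod (c n) * (rho / 2) ^ n * (1 / 2) ^ n) by ring.
        apply Rmult_le_compat_r; [apply pow_le; lra|apply HM]. }
    induction n as [|n IH].
    - rewrite sum_O; specialize (Ht O); rewrite pow_n_Cpow.
      change (Cmod (h ^ 0 * c O)%C <= 2 * M - M * (1 / 2) ^ 0); simpl in *; lra.
    - rewrite sum_Sn, pow_n_Cpow; specialize (Ht (S n)).
      eapply Rle_trans; [apply Cmod_triangle|].
      eapply Rle_trans; [apply Rplus_le_compat; [exact IH|exact Ht]|].
      simpl; lra. }
  assert (HL := H h ltac:(lra)).
  assert (Hev := proj1 (filterlim_locally_ball_norm _ _) HL (mkposreal 1 Rlt_0_1)).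
  destruct Hev as [N HN]; specialize (HN N (Nat.le_refl N)).
  specialize (HS N).
  set (s := sum_n (fun k => scal (@pow_n C_AbsRing h k) (c k) : C) N) in *.
  change (Cmod (minus s (f h)) < 1) in HN.
  assert (Hp : 0 <= M * (1 / 2) ^ N)
    by (apply Rmult_le_pos; [lra|apply pow_le; lra]).
  apply Rle_trans with (Cmod s + Cmod (minus s (f h))).
  - rewrite <- (Cmod_opp (minus s (f h))).
    eapply Rle_trans; [|apply Cmod_triangle].
    right; f_equal; unfold minus; change plus with Cplus; change opp with Copp; ring.
  - lra.
Qed.

(** Off the origin (f h - c 0)/h is the sum of the shifted series on the same disc; at the origin
    that series has the value [c 1]. Hence the induction keeps the same [rho]. *)
Lemma pseries_jet (N : nat) : forall (c : nat -> C) (f : C -> C) (rho : R),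
  0 < rho ->
  (forall h, Cmod h < rho -> @is_pseries C_AbsRing C_NormedModule c h (f h)) ->
  jet N f c.
Proof.
  induction N as [|N IH]; intros c f rho Hrho H.
  - exact (pseries_bounded c f rho Hrho H).
  - exists (fun h => if Ceq_dec h (RtoC 0) then c 1%nat else (/ h * (f h - c O))%C).
    split.
    + exists rho; split; [exact Hrho|]; intros h Hh.
      destruct (Ceq_dec h (RtoC 0)) as [->|Hn]; [|field; exact Hn].
      specialize (H (RtoC 0) Hh).
      assert (E : f (RtoC 0) = c O).
      { exact (@filterlim_locally_unique nat C_AbsRing C_NormedModule eventually
          _ _ _ _ H (@is_pseries_0 C_AbsRing C_NormedModule c)). }
      rewrite E; ring.
    + apply (IH _ _ rho Hrho); intros h Hh.
      destruct (Ceq_dec h (RtoC 0)) as [->|Hn]; [apply (@is_pseries_0 C_AbsRing C_NormedModule (shift c))|].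
      apply (@is_pseries_decr_1 C_AbsRing C_NormedModule c h (/ h)%C (f h)); [|auto].
      apply Cinv_l; exact Hn.
Qed.

(** * Compactness of the closed disc and the maximum principle *)

Lemma Cmod_lt_coords (z : C) (d : R) :
  Rabs (fst z) < d -> Rabs (snd z) < d -> Cmod z < 2 * d.
Proof.
  intros H1 H2.
  replace z with (RtoC (fst z) + Ci * RtoC (snd z))%C
    by (destruct z; unfold RtoC, Ci, Cplus, Cmult; simpl; f_equal; ring).
  eapply Rle_lt_trans; [apply Cmod_triangle|].
  rewrite Cmod_mult, Cmod_Ci, !Cmod_R; lra.
Qed.

(** Finitely many of the neighbourhoods cover the disc. A point [z] of the disc where [v] dominates
    the finitely many values v (p t) lies in one of them, which gives v z < v (p t) <= v z. *)
Lemma disc_cover (r : R) (v : C -> R) (p : C -> C) :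
  0 <= r -> (forall z, Cmod (p z) <= r) ->
  (forall z0, Cmod z0 <= r ->
    near0 (fun h => Cmod (z0 + h)%C <= r -> v (z0 + h)%C < v (p z0))) ->
  False.
Proof.
  intros Hr Hp Hv.
  assert (Hd : forall z0 : C, exists d : posreal, forall z,
    Cmod (z - z0)%C < 2 * d -> Cmod z <= r -> v z < v (p z0)).
  { intros z0; destruct (Rle_dec (Cmod z0) r) as [Hz|Hz].
    - destruct (Hv z0 Hz) as [d [Hd H]].
      assert (Hd2 : 0 < d / 2) by lra.
      exists (mkposreal _ Hd2); simpl; intros z H1 H2.
      replace z with (z0 + (z - z0))%C by ring.
      apply H; [lra|replace (z0 + (z - z0))%C with z by ring; exact H2].
    (* The cover will be one of a square, so centres outside the disc need a radius as well; this
       one makes the ball miss the disc. *)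
    - assert (Hd : 0 < (Cmod z0 - r) / 2) by lra.
      exists (mkposreal _ Hd); simpl; intros z H1 H2; exfalso.
      assert (H3 : Cmod z0 <= Cmod z + Cmod (z - z0)%C).
      { rewrite <- (Cmod_opp (z - z0)).
        eapply Rle_trans; [|apply Cmod_triangle]; right; f_equal; ring. }
      lra. }
  set (delta := fun z0 => proj1_sig (constructive_indefinite_description _ (Hd z0))).
  assert (Hdelta : forall z0 z, Cmod (z - z0)%C < 2 * delta z0 -> Cmod z <= r ->
    v z < v (p z0)).
  { intros z0; exact (proj2_sig (constructive_indefinite_description _ (Hd z0))). }
  set (pt := fun t : Compactness.Tn 2 R => (fst t, fst (snd t)) : C).
  (* Compactness of the square [-r, r]^2 comes under a double negation, which the goal [False]
     absorbs. *)
  apply (compactness_list 2 (-r, (-r, tt)) (r, (r, tt)) (fun t => delta (pt t))).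
  intros [l Hl].
  assert (Hmax : exists z, Cmod z <= r /\ forall t, In t l -> v (p (pt t)) <= v z).
  { clear Hl; induction l as [|t l [z [Hz IH]]].
    - exists (RtoC 0); rewrite Cmod_0; split; [exact Hr|intros t []].
    - destruct (Rle_dec (v (p (pt t))) (v z)) as [H|H].
      + exists z; split; [exact Hz|]; intros t' [<-|Ht']; auto.
      + exists (p (pt t)); split; [apply Hp|]; intros t' [<-|Ht']; [lra|].
        specialize (IH t' Ht'); lra. }
  destruct Hmax as [z [Hz Hmax]].
  generalize (Rmax_Cmod z); intros Hc.
  assert (Hb1 : Rabs (fst z) <= r).
  { eapply Rle_trans; [apply Rmax_l|eapply Rle_trans; [exact Hc|exact Hz]]. }
  assert (Hb2 : Rabs (snd z) <= r).
  { eapply Rle_trans; [apply Rmax_r|eapply Rle_trans; [exact Hc|exact Hz]]. }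
  apply Rabs_le_between in Hb1; apply Rabs_le_between in Hb2.
  destruct (Hl (fst z, (snd z, tt))) as [[t1 [t2 []]] [Hin [_ [H1 [H2 _]]]]].
  { simpl; tauto. }
  specialize (Hmax _ Hin).
  apply (Rlt_irrefl (v z)); eapply Rlt_le_trans; [|exact Hmax].
  apply Hdelta; [|exact Hz].
  apply Cmod_lt_coords; [exact H1|exact H2].
Qed.

(** Without a maximum every point [z0] of the disc is beaten by some [p z0] in it, by continuity
    also throughout a neighbourhood of [z0]; this contradicts [disc_cover]. *)
Lemma disc_max (r : R) (v : C -> R) :
  0 <= r ->
  (forall z0, Cmod z0 <= r ->
    forall eps, 0 < eps -> near0 (fun h => Rabs (v (z0 + h)%C - v z0) < eps)) ->
  exists z0, Cmod z0 <= r /\ forall z, Cmod z <= r -> v z <= v z0.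
Proof.
  intros Hr Hv; apply NNPP; intros Hn.
  assert (Hp : forall z0, exists p, Cmod p <= r /\ (Cmod z0 <= r -> v z0 < v p)).
  { intros z0; destruct (Rle_dec (Cmod z0) r) as [Hz|Hz].
    - apply NNPP; intros H; apply Hn; exists z0; split; [exact Hz|].
      intros z Hz'; apply Rnot_lt_le; intros Hlt; apply H; exists z; auto.
    - exists (RtoC 0); rewrite Cmod_0; tauto. }
  set (p := fun z0 => proj1_sig (constructive_indefinite_description _ (Hp z0))).
  assert (Hp' : forall z0, Cmod (p z0) <= r /\ (Cmod z0 <= r -> v z0 < v (p z0))).
  { intros z0; exact (proj2_sig (constructive_indefinite_description _ (Hp z0))). }
  apply (disc_cover r v p Hr); [intros z; apply Hp'|].
  intros z0 Hz; assert (H := proj2 (Hp' z0) Hz).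
  assert (H0 : 0 < v (p z0) - v z0) by lra.
  generalize (Hv z0 Hz _ H0); apply near0_imp; intros h Hh _.
  apply Rabs_def2 in Hh; lra.
Qed.

(* Second-order complex differentiability; this is all the maximum principle needs. *)
Definition smooth_at (F : C -> C) (z : C) : Prop :=
  exists c, jet 3 (fun h => F (z + h)%C) c.

Lemma Cmod_minus_le (x y : C) : Rabs (Cmod x - Cmod y) <= Cmod (x - y)%C.
Proof.
  apply Rabs_le; split.
  - assert (H : Cmod y <= Cmod x + Cmod (x - y)%C); [|lra].
    rewrite <- (Cmod_opp (x - y)).
    eapply Rle_trans; [|apply Cmod_triangle]; right; f_equal; ring.
  - assert (H : Cmod x <= Cmod y + Cmod (x - y)%C); [|lra].
    eapply Rle_trans; [|apply Cmod_triangle]; right; f_equal; ring.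
Qed.

Lemma smooth_lipschitz (F : C -> C) (z : C) : smooth_at F z ->
  exists K, 0 < K /\ near0 (fun h => Cmod (F (z + h) - F z)%C <= K * Cmod h).
Proof.
  intros [c J]; assert (H0 := jet_value _ _ _ J).
  cbv beta in H0; rewrite Cplus_0_r in H0.
  destruct J as [g [E J]]; destruct (jet_bounded _ _ _ J) as [K [HK B]].
  exists K; split; [exact HK|].
  generalize (near0_and _ _ E B); apply near0_imp; intros h [H1 H2].
  rewrite H1, H0.
  replace (c O + h * g h - c O)%C with (h * g h)%C by ring.
  rewrite Cmod_mult, Rmult_comm; apply Rmult_le_compat_r; [apply Cmod_ge_0|exact H2].
Qed.

(* Averaging over the fourth roots of unity kills the linear and quadratic terms. *)
Lemma smooth_four_points (F : C -> C) (z : C) : smooth_at F z ->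
  exists K, 0 < K /\ near0 (fun h =>
    4 * Cmod (F z) - K * Cmod h ^ 3 <=
      Cmod (F (z + h)%C) + Cmod (F (z + - h)%C)
      + Cmod (F (z + Ci * h)%C) + Cmod (F (z + - Ci * h)%C)).
Proof.
  intros [c J]; assert (H0 := jet_value _ _ _ J).
  cbv beta in H0; rewrite Cplus_0_r in H0.
  destruct J as [g1 [E1 [g2 [E2 [g3 [E3 [K HK]]]]]]].
  exists (4 * (Rabs K + 1)); split; [generalize (Rabs_pos K); lra|].
  assert (E : near0 (fun h => F (z + h)%C =
      (F z + c 1%nat * h + c 2%nat * (h * h) + h * h * h * g3 h)%C
      /\ Cmod (g3 h) <= Rabs K + 1)).
  { generalize (near0_and _ _ (near0_and _ _ E1 E2) (near0_and _ _ E3 HK)).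
    apply near0_imp; intros h [[H1 H2] [H3 H4]]; split.
    - rewrite H1, H2, H3, H0; unfold shift; ring.
    - generalize (Rle_abs K); lra. }
  generalize (near0_and _ _
    (near0_and _ _ E (near0_scale (- RtoC 1)%C _ E))
    (near0_and _ _ (near0_scale Ci _ E) (near0_scale (- Ci)%C _ E))).
  apply near0_imp; intros h [[[A1 B1] [A2 B2]] [[A3 B3] [A4 B4]]].
  replace (- RtoC 1 * h)%C with (- h)%C in * by ring.
  set (x1 := F (z + h)%C) in *; set (x2 := F (z + - h)%C) in *.
  set (x3 := F (z + Ci * h)%C) in *; set (x4 := F (z + - Ci * h)%C) in *.
  (* The cubes of -h, i h and -i h are -h^3, -i h^3 and i h^3, whence the signs and factors in the
     remainder. *)
  set (e := (h * h * h * (g3 h - g3 (- h) - Ci * g3 (Ci * h) + Ci * g3 (- Ci * h)))%C).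
  assert (HC : (Ci * Ci)%C = (- RtoC 1)%C)
    by (unfold Ci, Cmult, Copp, RtoC; simpl; f_equal; ring).
  assert (Es : (RtoC 4 * F z)%C = (x1 + x2 + x3 + x4 - e)%C).
  { rewrite A1, A2, A3, A4; unfold e.
    (* The added multiple of [1 + Ci * Ci], which is zero, makes both halves ring identities with
       [Ci] as an indeterminate. *)
    transitivity (RtoC 4 * F z
      + (RtoC 1 + Ci * Ci) * (RtoC 2 * c 2%nat * (h * h)
        + h * h * h * Ci * (g3 (Ci * h) - g3 (- Ci * h))))%C.
    - rewrite HC; ring.
    - ring. }
  assert (He : Cmod e <= 4 * (Rabs K + 1) * Cmod h ^ 3).
  { unfold e; rewrite !Cmod_mult.
    replace (4 * (Rabs K + 1) * Cmod h ^ 3)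
      with (Cmod h * Cmod h * Cmod h * (4 * (Rabs K + 1))) by ring.
    apply Rmult_le_compat_l.
    - repeat apply Rmult_le_pos; apply Cmod_ge_0.
    - unfold Cminus.
      eapply Rle_trans; [apply Cmod_triangle|].
      eapply Rle_trans; [apply Rplus_le_compat_r, Cmod_triangle|].
      eapply Rle_trans; [apply Rplus_le_compat_r, Rplus_le_compat_r, Cmod_triangle|].
      rewrite !Cmod_opp, !Cmod_mult, Cmod_Ci; lra. }
  assert (H4 : 4 * Cmod (F z) <= Cmod x1 + Cmod x2 + Cmod x3 + Cmod x4 + Cmod e).
  { replace (4 * Cmod (F z)) with (Cmod (RtoC 4 * F z)%C)
      by (rewrite Cmod_mult, Cmod_R, Rabs_pos_eq; lra).
    rewrite Es; unfold Cminus.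
    eapply Rle_trans; [apply Cmod_triangle|]; rewrite Cmod_opp.
    apply Rplus_le_compat_r.
    eapply Rle_trans; [apply Cmod_triangle|]; apply Rplus_le_compat_r.
    eapply Rle_trans; [apply Cmod_triangle|]; apply Rplus_le_compat_r.
    apply Cmod_triangle. }
  lra.
Qed.

(** The parallelogram law for [h] and for [Ci * h]. The surplus 4 |h|^2 is the gain that rules out
    an interior maximum. *)
Lemma Cmod2_four_points (z h : C) :
  Cmod (z + h)%C ^ 2 + Cmod (z + - h)%C ^ 2
    + Cmod (z + Ci * h)%C ^ 2 + Cmod (z + - Ci * h)%C ^ 2
  = 4 * Cmod z ^ 2 + 4 * Cmod h ^ 2.
Proof.
  rewrite !Cmod2_alt; destruct z as [a b], h as [x y].
  unfold Re, Im, Ci, Cplus, Copp, Cmult; simpl; ring.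
Qed.

Lemma max_principle_perturbed (F : C -> C) (r M e : R) :
  0 <= r -> 0 < e ->
  (forall z, Cmod z <= r -> smooth_at F z) ->
  (forall z, Cmod z = r -> Cmod (F z) <= M) ->
  forall z, Cmod z <= r -> Cmod (F z) <= M + e * r ^ 2.
Proof.
  intros Hr He HF HM z Hz.
  set (v := fun z => Cmod (F z) + e * Cmod z ^ 2).
  destruct (disc_max r v Hr) as [z0 [Hz0 Hmax]].
  { intros z0 Hz0 eps Heps.
    destruct (smooth_lipschitz F z0 (HF z0 Hz0)) as [K [HK HL]].
    (* A Lipschitz constant for [v] at [z0]: for |h| < 1, |z0 + h|^2 and |z0|^2 differ by at most (2
       |z0| + 1) |h|. *)
    set (L := K + e * (2 * Cmod z0 + 1)).
    assert (HL0 : 0 < L).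
    { unfold L; generalize (Cmod_ge_0 z0); nra. }
    generalize (near0_and _ _ HL (near0_and _ _ (near0_ball 1 Rlt_0_1)
      (near0_ball (eps / L) ltac:(apply Rdiv_lt_0_compat; lra)))).
    apply near0_imp; intros h [H1 [H2 H3]].
    assert (H4 := Rle_trans _ _ _ (Cmod_minus_le _ _) H1).
    assert (H5 : Rabs (Cmod (z0 + h)%C - Cmod z0) <= Cmod h).
    { eapply Rle_trans; [apply Cmod_minus_le|]; right; f_equal; ring. }
    assert (H6 : L * Cmod h < eps).
    { replace eps with (L * (eps / L)) by (field; lra).
      now apply Rmult_lt_compat_l. }
    unfold v.
    apply Rabs_le_between in H4; apply Rabs_le_between in H5.
    assert (H7 : Rabs (Cmod (z0 + h)%C ^ 2 - Cmod z0 ^ 2)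
      <= (2 * Cmod z0 + 1) * Cmod h).
    { generalize (Cmod_ge_0 z0) (Cmod_ge_0 h) (Cmod_ge_0 (z0 + h)%C); intros.
      apply Rabs_le; split; nra. }
    apply Rabs_le_between in H7.
    unfold L in H6; apply Rabs_def1; nra. }
  assert (Hedge : Cmod z0 = r).
  { destruct (Rle_lt_or_eq_dec _ _ Hz0) as [Hlt|]; [exfalso|assumption].
    destruct (smooth_four_points F z0 (HF z0 Hz0)) as [K [HK [d [Hd HL]]]].
    (* The three bounds keep the expansion valid, keep the four points in the disc, and make the
       loss K t^3 at most e t^2, less than the gain 4 e t^2. *)
    set (t := Rmin (d / 2) (Rmin ((r - Cmod z0) / 2) (e / K))).
    assert (Ht : 0 < t).
    { repeat apply Rmin_glb_lt; try lra; apply Rdiv_lt_0_compat; lra. }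
    assert (Ht1 : t <= d / 2) by apply Rmin_l.
    assert (Ht2 : t <= (r - Cmod z0) / 2)
      by (eapply Rle_trans; [apply Rmin_r|apply Rmin_l]).
    assert (Ht3 : t <= e / K)
      by (eapply Rle_trans; [apply Rmin_r|apply Rmin_r]).
    assert (Hm : Cmod (RtoC t) = t) by (rewrite Cmod_R; apply Rabs_pos_eq; lra).
    specialize (HL (RtoC t) ltac:(lra)).
    assert (Hsq := Cmod2_four_points z0 (RtoC t)).
    rewrite Hm in HL, Hsq.
    assert (Hin : forall h, Cmod h <= t -> Cmod (z0 + h)%C <= r).
    { intros h Hh; eapply Rle_trans; [apply Cmod_triangle|lra]. }
    assert (G1 := Hmax _ (Hin (RtoC t) ltac:(lra))).
    assert (G2 := Hmax _ (Hin (- RtoC t)%C ltac:(rewrite Cmod_opp; lra))).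
    assert (G3 := Hmax _ (Hin (Ci * RtoC t)%C
      ltac:(rewrite Cmod_mult, Cmod_Ci; lra))).
    assert (G4 := Hmax _ (Hin (- Ci * RtoC t)%C
      ltac:(rewrite Cmod_mult, Cmod_opp, Cmod_Ci; lra))).
    unfold v in G1, G2, G3, G4.
    assert (HKt : K * t <= e).
    { replace e with (K * (e / K)) by (field; lra).
      apply Rmult_le_compat_l; lra. }
    assert (Ht2' : 0 < t ^ 2) by (apply pow_lt; exact Ht).
    assert (K * t ^ 3 <= e * t ^ 2) by (simpl; simpl in Ht2'; nra).
    nra. }
  assert (H := Hmax z Hz); unfold v in H.
  rewrite Hedge in H; specialize (HM z0 Hedge).
  assert (0 <= e * Cmod z ^ 2) by (apply Rmult_le_pos; [lra|apply pow2_ge_0]).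
  lra.
Qed.

Lemma max_principle (F : C -> C) (r M : R) :
  0 <= r ->
  (forall z, Cmod z <= r -> smooth_at F z) ->
  (forall z, Cmod z = r -> Cmod (F z) <= M) ->
  forall z, Cmod z <= r -> Cmod (F z) <= M.
Proof.
  intros Hr HF HM z Hz; apply Rnot_lt_le; intros Hlt.
  assert (Hp : 0 < r ^ 2 + 1) by (generalize (pow2_ge_0 r); lra).
  (* The [+ 1] keeps the divisor positive and makes e r^2 strictly smaller than the excess of |F z|
     over [M]. *)
  set (e := (Cmod (F z) - M) / (r ^ 2 + 1)).
  assert (He : 0 < e) by (apply Rdiv_lt_0_compat; lra).
  assert (H := max_principle_perturbed F r M e Hr He HF HM z Hz).
  assert (E : e * (r ^ 2 + 1) = Cmod (F z) - M) by (unfold e; field; lra).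
  lra.
Qed.

(** * Closure properties of smoothness *)

Lemma smooth_ext (F G : C -> C) (z : C) :
  near0 (fun h => F (z + h)%C = G (z + h)%C) -> smooth_at F z -> smooth_at G z.
Proof. intros E [c J]; exists c; exact (jet_ext_fun _ _ _ _ E J). Qed.

Lemma smooth_const (x z : C) : smooth_at (fun _ => x) z.
Proof. exists (const_seq x); apply jet_const. Qed.

Lemma smooth_plus (F G : C -> C) (z : C) :
  smooth_at F z -> smooth_at G z -> smooth_at (fun z => F z + G z)%C z.
Proof. intros [c J] [d I]; eexists; exact (jet_plus _ _ _ _ _ J I). Qed.

Lemma smooth_mult (F G : C -> C) (z : C) :
  smooth_at F z -> smooth_at G z -> smooth_at (fun z => F z * G z)%C z.
Proof. intros [c J] [d I]; eexists; exact (jet_mult _ _ _ _ _ J I). Qed.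

Lemma smooth_inv (F : C -> C) (z : C) :
  F z <> RtoC 0 -> smooth_at F z -> smooth_at (fun z => / F z)%C z.
Proof.
  intros Hz [c J]; apply (jet_inv 2 (fun h => F (z + h)%C) c); [|exact J].
  rewrite <- (jet_value _ _ _ J); cbv beta; rewrite Cplus_0_r; exact Hz.
Qed.

Lemma smooth_pow (n : nat) (z : C) : smooth_at (fun z => z ^ n)%C z.
Proof.
  induction n as [|n IH]; [exact (smooth_const (RtoC 1) z)|].
  apply (smooth_mult (fun z => z) (fun z => z ^ n)%C); [apply jet_id|exact IH].
Qed.

Lemma smooth_scale (w : C) (F : C -> C) (z : C) :
  smooth_at F (w * z)%C -> smooth_at (fun z => F (w * z)%C) z.
Proof.
  intros [c J]; eexists; refine (jet_ext_fun _ _ _ _ _ (jet_scale 3 w _ _ J)).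
  exists 1; split; [lra|intros h _; f_equal; ring].
Qed.

Lemma smooth_sum (m : nat) (F : nat -> C -> C) (z : C) :
  (forall j, smooth_at (F j) z) -> smooth_at (fun z => sum_n (fun j => F j z) m) z.
Proof.
  intros H; induction m as [|m IH].
  - refine (smooth_ext (F O) _ z _ (H O)).
    exists 1; split; [lra|intros h _; now rewrite sum_O].
  - refine (smooth_ext _ _ z _ (smooth_plus _ _ z IH (H (S m)))).
    exists 1; split; [lra|intros h _; now rewrite sum_Sn].
Qed.

Lemma jet_sum (N m : nat) (F : nat -> C -> C) (c : nat -> nat -> C) :
  (forall j, jet N (F j) (c j)) ->
  jet N (fun h => sum_n (fun j => F j h) m) (fun k => sum_n (fun j => c j k) m).
Proof.
  intros H; induction m as [|m IH].
  - refine (jet_ext _ _ _ _ _ _ _ (H O)).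
    + exists 1; split; [lra|intros h _; now rewrite sum_O].
    + intros k _; now rewrite sum_O.
  - refine (jet_ext _ _ _ _ _ _ _ (jet_plus _ _ _ _ _ IH (H (S m)))).
    + exists 1; split; [lra|intros h _; now rewrite sum_Sn].
    + intros k _; now rewrite sum_Sn.
Qed.

Lemma smooth_at_0 (N : nat) (F : C -> C) (c : nat -> C) :
  (3 <= N)%nat -> jet N F c -> smooth_at F (RtoC 0).
Proof.
  intros HN J; exists c; refine (jet_ext_fun _ _ _ _ _ (jet_le _ _ _ _ HN J)).
  exists 1; split; [lra|intros h _; f_equal; ring].
Qed.

Lemma smooth_div_pow (n : nat) (F : C -> C) (c : nat -> C) (z : C) :
  (forall k, (k < n)%nat -> c k = RtoC 0) -> jet (n + 3) F c ->
  smooth_at F z -> smooth_at (div_pow n F (c n)) z.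
Proof.
  intros Hc J HF; destruct (Ceq_dec z (RtoC 0)) as [->|Hz].
  - apply (smooth_at_0 3 _ (fun k => c (n + k)%nat)); [lia|].
    exact (jet_div_pow n 2 F c Hc J).
  - apply (smooth_ext (fun z => F z * / z ^ n)%C).
    (* Within this radius [z + h] stays away from 0, so [div_pow] is the plain quotient there. *)
    + exists (Cmod z); split; [now apply Cmod_gt_0|]; intros h Hh.
      unfold div_pow; destruct (Ceq_dec (z + h)%C (RtoC 0)) as [E|]; [exfalso|reflexivity].
      assert (E' : z = (- h)%C).
      { replace z with (z + h - h)%C by ring; rewrite E; ring. }
      rewrite E', Cmod_opp in Hh; lra.
    + apply smooth_mult; [exact HF|].
      apply (smooth_inv (fun z => z ^ n)%C); [now apply Cpow_nz|apply smooth_pow].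
Qed.

(** * Schwarz's lemma and the first nonzero coefficient *)

(** Replaces a passage to the limit as [e] tends to 0, for errors linear in [e]. *)
Lemma le_of_le_plus_linear (x y K e0 : R) :
  0 < e0 -> (forall e, 0 < e < e0 -> x <= y + K * e) -> x <= y.
Proof.
  intros He0 H; apply Rnot_lt_le; intros Hlt.
  assert (HK : 0 < Rabs K + 1) by (generalize (Rabs_pos K); lra).
  set (e := Rmin (e0 / 2) ((x - y) / (2 * (Rabs K + 1)))).
  assert (He : 0 < e) by (apply Rmin_glb_lt; [lra|apply Rdiv_lt_0_compat; lra]).
  assert (He1 : e <= e0 / 2) by apply Rmin_l.
  assert (He2 : e * (2 * (Rabs K + 1)) <= x - y).
  { apply Rle_trans with
      ((x - y) / (2 * (Rabs K + 1)) * (2 * (Rabs K + 1))).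
    - apply Rmult_le_compat_r; [lra|apply Rmin_r].
    - right; field; lra. }
  specialize (H e ltac:(lra)); generalize (Rle_abs K); nra.
Qed.

Lemma bernoulli (n : nat) (e : R) : 0 <= e <= 1 -> 1 - INR n * e <= (1 - e) ^ n.
Proof.
  intros He; induction n as [|n IH]; [simpl; lra|].
  rewrite S_INR; simpl; generalize (pos_INR n); nra.
Qed.

(** On the circle |w| = 1 - e the quotient is at most (1 - e)^(-n), and the maximum principle
    carries this bound to [z] as soon as e < 1 - |z|. Bernoulli's inequality makes the error linear
    in [e]. The order [n + 3] leaves three orders after division, as smoothness at the origin
    demands. *)
Lemma schwarz (n : nat) (F : C -> C) (c : nat -> C) :
  (forall z, unit_disc z -> smooth_at F z) ->
  (forall z, unit_disc z -> Cmod (F z) <= 1) ->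
  jet (n + 3) F c -> (forall k, (k < n)%nat -> c k = RtoC 0) ->
  forall z, unit_disc z -> Cmod (div_pow n F (c n) z) <= 1.
Proof.
  intros HF HB J Hc z Hz; unfold unit_disc in *.
  set (D := div_pow n F (c n)).
  apply (le_of_le_plus_linear _ _ (INR n * Cmod (D z)) (1 - Cmod z)); [lra|].
  intros e He; assert (Hz0 := Cmod_ge_0 z).
  assert (Hr : 0 < (1 - e) ^ n) by (apply pow_lt; lra).
  assert (H : Cmod (D z) <= / (1 - e) ^ n).
  { apply (max_principle D (1 - e)); [lra| | |lra].
    - intros w Hw; apply smooth_div_pow; [exact Hc|exact J|apply HF; lra].
    - intros w Hw; unfold D, div_pow.
      destruct (Ceq_dec w (RtoC 0)) as [E|Hw0]; [rewrite E, Cmod_0 in Hw; lra|].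
      rewrite Cmod_div by (now apply Cpow_nz); rewrite Cmod_pow, Hw.
      rewrite <- (Rmult_1_l (/ _)); apply Rmult_le_compat_r.
      + left; now apply Rinv_0_lt_compat.
      + apply HB; lra. }
  assert (H1 : Cmod (D z) * (1 - e) ^ n <= 1).
  { apply (Rmult_le_compat_r ((1 - e) ^ n)) in H; [|lra].
    rewrite Rinv_l in H by lra; exact H. }
  assert (H2 := bernoulli n e ltac:(lra)).
  generalize (Cmod_ge_0 (D z)); nra.
Qed.

Lemma conv_vanish (n : nat) : forall (p e : nat -> C),
  (forall k, (k < n)%nat -> p k = RtoC 0) ->
  (forall k, (k < n)%nat -> conv p e k = RtoC 0) /\ conv p e n = (p n * e O)%C.
Proof.
  induction n as [|n IH]; intros p e Hp; [split; [lia|reflexivity]|].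
  destruct (IH (shift p) e) as [H1 H2].
  { intros k Hk; apply Hp; lia. }
  assert (H0 := Hp O ltac:(lia)); split.
  - intros [|k] Hk; simpl; rewrite H0; [ring|].
    rewrite H1 by lia; ring.
  - simpl; rewrite H0, H2; unfold shift; ring.
Qed.

(** The difference of the squared moduli factors as (1 - |a|^2)(1 - |b|^2). *)
Lemma moebius_le (a b : C) : Cmod a <= 1 -> Cmod b <= 1 ->
  Cmod (b - a)%C <= Cmod (1 - Cconj a * b)%C.
Proof.
  intros Ha Hb.
  assert (E : Cmod (1 - Cconj a * b)%C ^ 2 - Cmod (b - a)%C ^ 2
    = (1 - Cmod a ^ 2) * (1 - Cmod b ^ 2)).
  { rewrite !Cmod2_alt; destruct a, b.
    unfold Re, Im, Cconj, Cminus, Cplus, Copp, Cmult, RtoC; simpl; ring. }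
  assert (Ha2 : Cmod a ^ 2 <= 1) by (generalize (Cmod_ge_0 a); nra).
  assert (Hb2 : Cmod b ^ 2 <= 1) by (generalize (Cmod_ge_0 b); nra).
  generalize (Cmod_ge_0 (b - a)%C) (Cmod_ge_0 (1 - Cconj a * b)%C); nra.
Qed.

(* Schwarz's lemma applied to [(psi - d 0) / (1 - conj (d 0) psi)]. *)
Lemma schwarz_pick_coeff (n : nat) (s : R) (psi : C -> C) (d : nat -> C) :
  0 < s < 1 -> (0 < n)%nat ->
  (forall z, unit_disc z -> smooth_at psi z) ->
  (forall z, unit_disc z -> Cmod (psi z) <= s) ->
  jet (n + 3) psi d -> (forall k, (0 < k < n)%nat -> d k = RtoC 0) ->
  Cmod (d n) <= 1 - Cmod (d O) ^ 2.
Proof.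
  intros Hs Hn HF HB J Hd.
  assert (Hd0 : psi (RtoC 0) = d O).
  { apply (jet_value (n + 2)); replace (S (n + 2)) with (n + 3)%nat by lia; exact J. }
  assert (H0 : unit_disc (RtoC 0)) by (unfold unit_disc; rewrite Cmod_0; lra).
  assert (Hd0s : Cmod (d O) <= s) by (rewrite <- Hd0; now apply HB).
  set (den := fun z => (1 + (- Cconj (d O)) * psi z)%C).
  (* Here s < 1 matters: both |d 0| and |psi z| are at most [s], so their product cannot reach 1. *)
  assert (Hden : forall z, unit_disc z -> den z <> RtoC 0).
  { intros z Hz E.
    assert (E1 : RtoC 1 = (Cconj (d O) * psi z)%C).
    { replace (RtoC 1) with (den z + Cconj (d O) * psi z)%C by (unfold den; ring).
      rewrite E; ring. }
    apply (f_equal Cmod) in E1; rewrite Cmod_1, Cmod_mult, Cmod_conj in E1.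
    generalize (HB z Hz) (Cmod_ge_0 (psi z)) (Cmod_ge_0 (d O)); nra. }
  assert (Sden : forall z, unit_disc z -> smooth_at den z).
  { intros z Hz; apply smooth_plus; [apply smooth_const|].
    apply (smooth_mult (fun _ => - Cconj (d O))%C psi); [apply smooth_const|auto]. }
  assert (Jden := jet_plus _ _ _ _ _ (jet_const (n + 3) (RtoC 1))
    (jet_smult (n + 3) (- Cconj (d O))%C _ _ J)).
  assert (Hv : (1 + - Cconj (d O) * d O)%C = RtoC (1 - Cmod (d O) ^ 2)).
  { rewrite RtoC_minus, Cmod2_conj; ring. }
  assert (Hpos : 0 < 1 - Cmod (d O) ^ 2) by (generalize (Cmod_ge_0 (d O)); nra).
  destruct (jet_inv (n + 2) den
    (fun k => const_seq (RtoC 1) k + - Cconj (d O) * d k)%C) as [e Je].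
  { simpl; rewrite Hv; intros E; apply RtoC_inj in E; lra. }
  { replace (S (n + 2)) with (n + 3)%nat by lia; exact Jden. }
  assert (He0 : e O = (/ RtoC (1 - Cmod (d O) ^ 2))%C).
  { rewrite <- (jet_value _ _ _ Je); unfold den; now rewrite Hd0, Hv. }
  replace (S (n + 2)) with (n + 3)%nat in Je by lia.
  assert (Jnum := jet_plus _ _ _ _ _ J (jet_const (n + 3) (- d O)%C)).
  assert (JQ := jet_mult _ _ _ _ _ Jnum Je).
  set (p := fun k => (d k + const_seq (- d O) k)%C) in *.
  destruct (conv_vanish n p e) as [V1 V2].
  { intros [|k] Hk; unfold p; simpl; [ring|rewrite Hd by lia; ring]. }
  assert (HS := schwarz n (fun z => (psi z + - d O) * / den z)%C (conv p e)).
  (* Schwarz's lemma is evaluated at the origin, where the divided function takes its coefficient as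
     value. *)
  assert (HQ : Cmod (conv p e n) <= 1).
  { assert (HD : forall F x, div_pow n F x (RtoC 0) = x).
    { intros F x; unfold div_pow; destruct (Ceq_dec 0 0) as [|N]; [reflexivity|].
      exfalso; now apply N. }
    rewrite <- (HD (fun z => (psi z + - d O) * / den z)%C (conv p e n)).
    apply HS; auto.
    - intros z Hz; apply smooth_mult.
      + apply smooth_plus; [auto|apply smooth_const].
      + apply (smooth_inv den); auto.
    - intros z Hz; rewrite Cmod_mult, Cmod_inv by auto.
      assert (Hp : 0 < Cmod (den z)) by (apply Cmod_gt_0; auto).
      rewrite <- (Rinv_r (Cmod (den z))) by lra.
      apply Rmult_le_compat_r; [left; now apply Rinv_0_lt_compat|].
      replace (den z) with (1 - Cconj (d O) * psi z)%C by (unfold den; ring).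
      apply (moebius_le (d O) (psi z)); [lra|specialize (HB z Hz); lra]. }
  assert (Hpn : p n = d n).
  { unfold p; destruct n as [|m]; [lia|simpl; ring]. }
  (* The leading coefficient of the Moebius transform is d n / (1 - |d 0|^2). *)
  rewrite V2, Hpn, He0, Cmod_mult, <- RtoC_inv, Cmod_R in HQ by lra.
  rewrite Rabs_pos_eq in HQ by (left; now apply Rinv_0_lt_compat).
  apply (Rmult_le_compat_r (1 - Cmod (d O) ^ 2)) in HQ; [|lra].
  rewrite Rmult_assoc, Rinv_l in HQ by lra; lra.
Qed.

(** * Roots of unity and sums over them *)

Definition unity_root (n : nat) : C :=
  (cos (2 * PI / INR n), sin (2 * PI / INR n)).

Lemma cos_sin_pow (x : R) (k : nat) :
  ((cos x, sin x) ^ k)%C = (cos (INR k * x), sin (INR k * x)).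
Proof.
  induction k as [|k IH].
  - simpl; rewrite Rmult_0_l, cos_0, sin_0; reflexivity.
  - rewrite Cpow_S, IH, S_INR.
    replace ((INR k + 1) * x) with (x + INR k * x) by ring.
    rewrite cos_plus, sin_plus; unfold Cmult; simpl; f_equal; ring.
Qed.

Lemma unity_root_pow (n : nat) : (0 < n)%nat -> (unity_root n ^ n)%C = RtoC 1.
Proof.
  intros Hn; unfold unity_root; rewrite cos_sin_pow.
  replace (INR n * (2 * PI / INR n)) with (2 * PI)
    by (field; apply not_0_INR; lia).
  rewrite cos_2PI, sin_2PI; reflexivity.
Qed.

(** With x = k pi / n strictly between 0 and pi, the real part is cos (2 x) = 1 - 2 sin(x)^2 < 1. *)
Lemma unity_root_primitive (n k : nat) :
  (0 < k < n)%nat -> (unity_root n ^ k)%C <> RtoC 1.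
Proof.
  intros Hk E; unfold unity_root in E; rewrite cos_sin_pow in E.
  apply (f_equal fst) in E; simpl in E.
  set (x := INR k * PI / INR n).
  assert (Hn : 0 < INR n) by (apply lt_0_INR; lia).
  assert (Hk0 : 0 < INR k) by (apply lt_0_INR; lia).
  assert (Hkn : INR k < INR n) by (apply lt_INR; lia).
  assert (HPI := PI_RGT_0).
  replace (INR k * (2 * PI / INR n)) with (2 * x) in E by (unfold x; field; lra).
  rewrite cos_2a_sin in E.
  assert (Hs : 0 < sin x).
  { apply sin_gt_0; unfold x.
    - apply Rdiv_lt_0_compat; nra.
    - apply (Rmult_lt_reg_r (INR n)); [lra|].
      unfold Rdiv; rewrite Rmult_assoc, Rinv_l by lra; nra. }
  nra.
Qed.

Lemma Cmod_unity_root (n : nat) : Cmod (unity_root n) = 1.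
Proof.
  assert (H : Cmod (unity_root n) ^ 2 = 1).
  { rewrite Cmod2_alt; unfold unity_root, Re, Im; simpl.
    generalize (sin2_cos2 (2 * PI / INR n)); unfold Rsqr; lra. }
  generalize (Cmod_ge_0 (unity_root n)); nra.
Qed.

Lemma geometric_sum (u : C) (m : nat) :
  ((u - 1) * sum_n (fun j => u ^ j)%C m)%C = (u ^ S m - 1)%C.
Proof.
  induction m as [|m IH]; [rewrite sum_O; simpl; ring|].
  rewrite sum_Sn; change plus with Cplus.
  rewrite Cmult_plus_distr_l, IH, !Cpow_S; ring.
Qed.

Lemma Cmod_sum_le (u : nat -> C) (m : nat) :
  (forall j, Cmod (u j) <= 1) -> Cmod (sum_n u m) <= INR (S m).
Proof.
  intros H; induction m as [|m IH].
  - rewrite sum_O; simpl; apply H.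
  - rewrite sum_Sn, S_INR; eapply Rle_trans; [apply Cmod_triangle|].
    generalize (H (S m)); lra.
Qed.

(** * The Schur class and Wiener's inequality *)

(** The Schur class of the disc, with analyticity reduced to what the argument consumes: smoothness
    at each point and a single coefficient sequence for expansions of every order at the origin. *)
Definition schur (F : C -> C) (c : nat -> C) : Prop :=
  (forall z, unit_disc z -> smooth_at F z) /\
  (forall z, unit_disc z -> Cmod (F z) <= 1) /\
  (forall N, jet N F c).

Lemma schur_mult (F G : C -> C) (c d : nat -> C) :
  schur F c -> schur G d -> schur (fun z => F z * G z)%C (conv c d).
Proof.
  intros [F1 [F2 F3]] [G1 [G2 G3]]; split; [|split].
  - intros z Hz; apply smooth_mult; auto.
  - intros z Hz; rewrite Cmod_mult.
    generalize (F2 z Hz) (G2 z Hz) (Cmod_ge_0 (F z)) (Cmod_ge_0 (G z)); nra.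
  - intros N; apply jet_mult; auto.
Qed.

Lemma schur_of_analytic (F : C -> C) :
  analytic_on unit_disc F -> (forall z, unit_disc z -> Cmod (F z) <= 1) ->
  exists c, schur F c.
Proof.
  intros HF HB.
  assert (HJ : forall z, unit_disc z -> exists c, forall N,
    jet N (fun h => F (z + h)%C) c).
  { intros z Hz; destruct (HF z Hz) as [c [rho [Hr Hc]]].
    exists c; intros N; apply (pseries_jet N c _ rho Hr); intros h Hh.
    assert (E : (z + h - z)%C = h) by ring.
    specialize (Hc (z + h)%C); rewrite E in Hc; auto. }
  destruct (HJ (RtoC 0)) as [c Hc].
  { unfold unit_disc; rewrite Cmod_0; lra. }
  exists c; split; [|split; [exact HB|]].
  - intros z Hz; destruct (HJ z Hz) as [d Hd]; exists d; apply Hd.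
  - intros N; refine (jet_ext_fun _ _ _ _ _ (Hc N)).
    exists 1; split; [lra|intros h _; f_equal; ring].
Qed.

(** Applied to [omega], this yields the factor [sigma] with omega z = z sigma z. *)
Lemma schur_div (F : C -> C) (c : nat -> C) :
  schur F c -> c O = RtoC 0 -> schur (div_pow 1 F (c 1%nat)) (shift c).
Proof.
  intros [F1 [F2 F3]] H0.
  assert (Hc : forall k, (k < 1)%nat -> c k = RtoC 0).
  { intros k Hk; now replace k with O by lia. }
  split; [|split].
  - intros z Hz; apply smooth_div_pow; auto.
  - apply schwarz; auto.
  - intros N; apply jet_weaken; exact (jet_div_pow 1 N F c Hc (F3 _)).
Qed.

(* Averaging [F] over rotations by the [n]-th roots of unity keeps [c 0] and
   [c n] and kills the coefficients in between. *)
Lemma schur_coeff_scaled (F : C -> C) (c : nat -> C) (n : nat) (s : R) :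
  schur F c -> (0 < n)%nat -> 0 < s < 1 ->
  s * Cmod (c n) <= 1 - (s * Cmod (c O)) ^ 2.
Proof.
  intros [F1 [F2 F3]] Hn Hs.
  destruct n as [|m]; [lia|]; clear Hn.
  set (w := unity_root (S m)).
  assert (Hw : forall j, Cmod (w ^ j)%C = 1).
  { intros j; rewrite Cmod_pow; unfold w; rewrite Cmod_unity_root; apply pow1. }
  assert (Hrot : forall j z, unit_disc z -> unit_disc (w ^ j * z)%C).
  { intros j z Hz; unfold unit_disc; rewrite Cmod_mult, Hw, Rmult_1_l; exact Hz. }
  assert (HI : 0 < INR (S m)) by (apply lt_0_INR; lia).
  (* One over the number of rotations gives the average; the extra factor [s] supplies the bound
     below 1 required by [schwarz_pick_coeff]. *)
  set (x := s / INR (S m)).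
  assert (Hx : 0 < x) by (apply Rdiv_lt_0_compat; lra).
  assert (Hxm : Cmod (RtoC x) = x) by (rewrite Cmod_R; apply Rabs_pos_eq; lra).
  set (psi := fun z => (RtoC x * sum_n (fun j => F (w ^ j * z)%C) m)%C).
  set (d := fun k => (RtoC x * sum_n (fun j => (w ^ j) ^ k * c k)%C m)%C).
  (* Exchanging the exponents [j] and [k] turns the average into a geometric sum with ratio
     [w ^ k]. *)
  assert (Hd : forall k, d k = (RtoC x * (c k * sum_n (fun j => (w ^ k) ^ j)%C m))%C).
  { intros k; unfold d; f_equal.
    rewrite <- (sum_n_mult_l (c k : C_Ring)); apply sum_n_ext; intros j.
    rewrite <- !Cpow_mult_r, (Nat.mul_comm j k).
    change mult with Cmult; apply Cmult_comm. }
  assert (Hone : forall k, (w ^ k)%C = RtoC 1 -> Cmod (d k) = s * Cmod (c k)).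
  { intros k Hk; rewrite Hd, Hk.
    assert (E : sum_n (fun j => RtoC 1 ^ j)%C m = RtoC (INR (S m))).
    { clear; induction m as [|m IH]; [now rewrite sum_O|].
      rewrite sum_Sn, IH, Cpow_1_l, (S_INR (S m)), RtoC_plus; reflexivity. }
    rewrite E, !Cmod_mult, Hxm, Cmod_R, Rabs_pos_eq by lra.
    unfold x; field; lra. }
  assert (H := schwarz_pick_coeff (S m) s psi d Hs ltac:(lia)).
  rewrite (Hone (S m)), (Hone O) in H.
  - apply H.
    + intros z Hz; apply (smooth_mult (fun _ => RtoC x)); [apply smooth_const|].
      apply (smooth_sum m (fun j z => F (w ^ j * z)%C)); intros j.
      apply smooth_scale; auto.
    + intros z Hz; unfold psi; rewrite Cmod_mult, Hxm.
      replace s with (x * INR (S m)) by (unfold x; field; lra).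
      apply Rmult_le_compat_l; [lra|]; apply Cmod_sum_le; auto.
    + apply (jet_smult _ (RtoC x) _
        (fun k => sum_n (fun j => (w ^ j) ^ k * c k)%C m)).
      apply (jet_sum _ m (fun j z => F (w ^ j * z)%C)
        (fun j k => (w ^ j) ^ k * c k)%C).
      intros j; apply jet_scale; auto.
    + intros k Hk; rewrite Hd.
      (* The ratio differs from 1 but its power [S m] equals 1, so the geometric sum vanishes. *)
      assert (G := geometric_sum (w ^ k)%C m).
      assert (E : ((w ^ k) ^ S m)%C = RtoC 1).
      { rewrite <- Cpow_mult_r, Nat.mul_comm, Cpow_mult_r.
        unfold w; rewrite unity_root_pow by lia; apply Cpow_1_l. }
      rewrite E in G.
      assert (Hne : (w ^ k - 1)%C <> RtoC 0).
      { intros Z; apply (unity_root_primitive (S m) k Hk); fold w.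
        replace (w ^ k)%C with (w ^ k - 1 + 1)%C by ring; rewrite Z; ring. }
      set (t := sum_n (fun j => (w ^ k) ^ j)%C m : C) in *.
      assert (G0 : t = RtoC 0).
      { transitivity (/ (w ^ k - 1) * ((w ^ k - 1) * t))%C.
        - field; exact Hne.
        - rewrite G; ring. }
      rewrite G0; ring.
  - reflexivity.
  - apply unity_root_pow; lia.
Qed.

(** Wiener's inequality, obtained from the scaled form with s = 1 - e as [e] tends to 0. *)
Lemma schur_coeff (F : C -> C) (c : nat -> C) (n : nat) :
  schur F c -> (0 < n)%nat -> Cmod (c n) <= 1 - Cmod (c O) ^ 2.
Proof.
  intros HF Hn.
  apply (le_of_le_plus_linear _ _ (2 * Cmod (c O) ^ 2 + Cmod (c n)) 1 Rlt_0_1).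
  intros e He.
  assert (H := schur_coeff_scaled F c n (1 - e) HF Hn ltac:(lra)).
  generalize (Cmod_ge_0 (c n)) (pow2_ge_0 (Cmod (c O))) (pow2_ge_0 e).
  rewrite Rpow_mult_distr in H; nra.
Qed.

(** * Bohr's inequality and its transfer to compositions *)

(** With A = |c 0|, Wiener's inequality bounds the tail by (1 - A^2) times the sum of 3^(-k) over k
    >= 1, which is 1/2; and A + (1 - A^2)/2 = 1 - (1 - A)^2/2. *)
Lemma bohr (F : C -> C) (c : nat -> C) (r : R) (N : nat) :
  schur F c -> 0 <= r <= 1 / 3 -> sum_n (fun k => Cmod (c k) * r ^ k) N <= 1.
Proof.
  intros HF Hr.
  assert (HA := proj1 (proj2 HF) (RtoC 0)
    ltac:(unfold unit_disc; rewrite Cmod_0; lra)).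
  rewrite (jet_value _ _ _ (proj2 (proj2 HF) 1%nat)) in HA.
  set (A := Cmod (c O)) in *.
  assert (HA0 : 0 <= A) by apply Cmod_ge_0.
  assert (H : sum_n (fun k => Cmod (c k) * r ^ k) N
    <= A + (1 - A ^ 2) / 2 * (1 - (1 / 3) ^ N)).
  { induction N as [|N IH].
    - rewrite sum_O; fold A; simpl; lra.
    - rewrite sum_Sn; change plus with Rplus.
      assert (Hc := schur_coeff F c (S N) HF ltac:(lia)); fold A in Hc.
      assert (Hp : r ^ S N <= (1 / 3) ^ S N) by (apply pow_incr; lra).
      assert (Hp0 : 0 <= r ^ S N) by (apply pow_le; lra).
      assert (Ht : Cmod (c (S N)) * r ^ S N <= (1 - A ^ 2) * (1 / 3) ^ S N).
      { apply Rmult_le_compat; auto using Cmod_ge_0. }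
      change ((1 / 3) ^ S N) with (1 / 3 * (1 / 3) ^ N) in *; nra. }
  assert (Hx : 0 <= (1 / 3) ^ N) by (apply pow_le; lra).
  assert (HA2 : 0 <= 1 - A ^ 2) by nra.
  assert (Hm := Rmult_le_pos _ _ HA2 Hx).
  generalize (pow2_ge_0 (1 - A)); nra.
Qed.

(* Taylor coefficients of [Phi h * g (h * sigma h)], where [p], [s] and [b] are
   those of [Phi], [sigma] and [g]. *)
Fixpoint comp (p s b : nat -> C) (n : nat) {struct n} : C :=
  match n with
  | O => (b O * p O)%C
  | S n => (b O * p (S n) + comp (conv p s) s (shift b) n)%C
  end.

Lemma near0_comp (sigma : C -> C) (c : nat -> C) (N : nat) (P : C -> Prop) :
  jet N sigma c -> near0 P -> near0 (fun h => P (h * sigma h)%C).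
Proof.
  intros J [d [Hd HP]]; destruct (jet_bounded _ _ _ J) as [K [HK B]].
  generalize (near0_and _ _ B
    (near0_ball (d / K) ltac:(apply Rdiv_lt_0_compat; lra))).
  apply near0_imp; intros h [H1 H2]; apply HP; rewrite Cmod_mult.
  apply Rle_lt_trans with (Cmod h * K).
  - apply Rmult_le_compat_l; [apply Cmod_ge_0|exact H1].
  - replace d with (d / K * K) by (field; lra).
    now apply Rmult_lt_compat_r.
Qed.

(** If g(w) = b 0 + w g1(w), then Phi g(h sigma) = b 0 Phi + h (Phi sigma) g1(h sigma). The last
    factor has the original shape with [Phi] replaced by Phi sigma, which is the recursion of
    [comp]. *)
Lemma jet_comp (N : nat) : forall (Phi sigma g : C -> C) (p s b : nat -> C),
  jet N Phi p -> jet N sigma s -> jet N g b ->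
  jet N (fun h => Phi h * g (h * sigma h))%C (comp p s b).
Proof.
  induction N as [|N IH]; intros Phi sigma g p s b JP JS Jg.
  - destruct (jet_bounded _ _ _ JP) as [K [HK BP]].
    destruct (jet_bounded _ _ _ Jg) as [L [HL Bg]].
    exists (K * L).
    generalize (near0_and _ _ BP (near0_comp _ _ _ _ JS Bg)); apply near0_imp.
    intros h [H1 H2]; rewrite Cmod_mult.
    apply Rmult_le_compat; auto using Cmod_ge_0.
  - generalize JP; intros [P1 [EP JP1]]; destruct Jg as [g1 [Eg Jg1]].
    exists (fun h => b O * P1 h + Phi h * sigma h * g1 (h * sigma h))%C; split.
    + generalize (near0_and _ _ EP (near0_comp _ _ _ _ JS Eg)); apply near0_imp.
      intros h [H1 H2]; rewrite H2, H1; simpl; ring.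
    + apply jet_weaken in JP; apply jet_weaken in JS.
      exact (jet_plus N _ _ _ _ (jet_smult N (b O) _ _ JP1)
        (IH _ _ _ _ _ _ (jet_mult N _ _ _ _ JP JS) JS Jg1)).
Qed.

Lemma sum_n_S (u : nat -> R) (N : nat) :
  sum_n u (S N) = u O + sum_n (fun k => u (S k)) N.
Proof. unfold sum_n; rewrite sum_n_m_S, sum_Sn_m by lia; reflexivity. Qed.

(** The induction ranges over all Schur functions [Phi], since each step replaces [Phi] by Phi
    sigma, again a Schur function. Bohr's inequality for the current [Phi] bounds the part weighted
    by |b 0|; the remainder carries a factor [r] and the shifted sequence [b]. *)
Lemma comp_majorant (r : R) (sigma : C -> C) (s : nat -> C) :
  0 <= r <= 1 / 3 -> schur sigma s ->
  forall (N : nat) (Phi : C -> C) (p b : nat -> C), schur Phi p ->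
  sum_n (fun n => Cmod (comp p s b n) * r ^ n) N
    <= sum_n (fun k => Cmod (b k) * r ^ k) N.
Proof.
  intros Hr HS; induction N as [|N IH]; intros Phi p b HP.
  - assert (B := bohr Phi p r O HP Hr); rewrite sum_O in B; rewrite !sum_O.
    simpl in *; rewrite Cmod_mult; generalize (Cmod_ge_0 (b O)); nra.
  - specialize (IH _ _ (shift b) (schur_mult _ _ _ _ HP HS)).
    assert (B := bohr Phi p r (S N) HP Hr).
    rewrite (sum_n_S (fun k => Cmod (b k) * r ^ k)).
    apply Rle_trans with
      (Cmod (b O) * sum_n (fun k => Cmod (p k) * r ^ k) (S N)
        + r * sum_n (fun n => Cmod (comp (conv p s) s (shift b) n) * r ^ n) N).
    + rewrite !sum_n_S, Rmult_plus_distr_l, Rplus_assoc.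
      apply Rplus_le_compat; [simpl; rewrite Cmod_mult; lra|].
      rewrite <- !(sum_n_mult_l (K := R_Ring)), <- (sum_n_plus (G := R_AbelianMonoid)).
      apply sum_n_m_le; intros k.
      change mult with Rmult; change plus with Rplus; simpl.
      assert (Ht := Cmod_triangle (b O * p (S k)) (comp (conv p s) s (shift b) k)).
      rewrite Cmod_mult in Ht.
      assert (Hk : 0 <= r * r ^ k).
      { apply Rmult_le_pos; [lra|apply pow_le; lra]. }
      apply (Rmult_le_compat_r _ _ _ Hk) in Ht; lra.
    + replace (sum_n (fun k => Cmod (b (S k)) * r ^ S k) N)
        with (r * sum_n (fun k => Cmod (shift b k) * r ^ k) N).
      * simpl (r ^ 0); generalize (Cmod_ge_0 (b O)); nra.
      * rewrite <- (sum_n_mult_l (K := R_Ring)); apply sum_n_ext; intros k.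
        change mult with Rmult; unfold shift; simpl; ring.
Qed.

(** * Convergence of the majorant series and the conclusion *)

(** The terms are bounded at a radius [q] strictly between [r] and 1, which leaves a geometric
    series of ratio r/q < 1. *)
Lemma pseries_majorant_ex (c : nat -> C) (f : C -> C) (r : R) :
  (forall z, unit_disc z -> @is_pseries C_AbsRing C_NormedModule c z (f z)) ->
  0 <= r < 1 -> ex_series (fun k => Cmod (c k) * r ^ k).
Proof.
  intros Hc Hr.
  set (q := (1 + r) / 2).
  assert (Hq : Cmod (RtoC q) = q)
    by (rewrite Cmod_R; apply Rabs_pos_eq; unfold q; lra).
  assert (Hd : unit_disc (RtoC q)) by (unfold unit_disc; rewrite Hq; unfold q; lra).
  destruct (pseries_coeff_bound c (RtoC q) _ (Hc _ Hd)) as [M HM].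
  rewrite Hq in HM.
  assert (Hq0 : 0 < q) by (unfold q; lra).
  assert (Hrq : 0 <= r / q < 1).
  { split; [apply Rdiv_le_0_compat; lra|].
    apply (Rmult_lt_reg_r q); [lra|].
    unfold Rdiv; rewrite Rmult_assoc, Rinv_l by lra; unfold q; lra. }
  apply (@ex_series_le R_AbsRing R_CompleteNormedModule _ (fun k => M * (r / q) ^ k)).
  - intros k.
    assert (Hk : 0 <= (r / q) ^ k) by (apply pow_le; lra).
    assert (E : Cmod (c k) * r ^ k = Cmod (c k) * q ^ k * (r / q) ^ k).
    { rewrite Rmult_assoc, <- Rpow_mult_distr; do 2 f_equal; field; lra. }
    change norm with Rabs; rewrite Rabs_pos_eq.
    + rewrite E; apply Rmult_le_compat_r; [exact Hk|apply HM].
    + apply Rmult_le_pos; [apply Cmod_ge_0|apply pow_le; lra].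
  - apply (@ex_series_scal R_AbsRing R_NormedModule M (fun k => (r / q) ^ k)).
    apply ex_series_geom; rewrite Rabs_pos_eq; lra.
Qed.

Lemma Series_le_partial (u v : nat -> R) :
  ex_series u -> ex_series v -> (forall N, sum_n u N <= sum_n v N) ->
  Series u <= Series v.
Proof.
  intros Hu Hv H.
  exact (is_lim_seq_le _ _ (Series u) (Series v) H
    (Series_correct _ Hu) (Series_correct _ Hv)).
Qed.

Theorem theorem2p1 (f g : C -> C) (a b : nat -> C)
  (hf : analytic_on unit_disc f)
  (hg : analytic_on unit_disc g)
  (hfa : forall z : C, unit_disc z -> @is_pseries C_AbsRing C_NormedModule a z (f z))
  (hgb : forall z : C, unit_disc z -> @is_pseries C_AbsRing C_NormedModule b z (g z))
  (hfg : quasi_subordinate f g) :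
  forall r : R, 0 <= r <= 1 / 3 ->
    Series (fun k : nat => Cmod (a k) * r ^ k)
      <= Series (fun k : nat => Cmod (b k) * r ^ k).
Proof.
  intros r Hr.
  destruct hfg as [Phi [omega [HP [HO [H0 [HB HE]]]]]].
  destruct (schur_of_analytic Phi HP) as [p SP]; [intros z Hz; now apply HB|].
  destruct (schur_of_analytic omega HO) as [o SO]; [intros z Hz; now apply HB|].
  assert (Ho : o O = RtoC 0).
  { rewrite <- (jet_value 0 omega o); [exact H0|apply SO]. }
  assert (SS := schur_div omega o SO Ho).
  (* Both sides are coefficients of [f] at the origin: off 0, [omega h] equals [h] times its divided
     form, so uniqueness of expansions applies. *)
  assert (Hab : forall n, a n = comp p (shift o) b n).
  { intros n.
    apply (jet_unique (S n) f
      (fun h => Phi h * g (h * div_pow 1 omega (o 1%nat) h))%C); [| | |lia].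
    - exists 1; split; [lra|]; intros h Hh Hn.
      rewrite (HE h Hh); do 2 f_equal; unfold div_pow.
      destruct (Ceq_dec h (RtoC 0)) as [E|_]; [contradiction|].
      simpl; field; exact Hn.
    - exact (pseries_jet (S n) a f 1 Rlt_0_1 hfa).
    - apply jet_comp; [apply SP|apply SS|exact (pseries_jet (S n) b g 1 Rlt_0_1 hgb)]. }
  apply Series_le_partial.
  - apply (pseries_majorant_ex a f r hfa); lra.
  - apply (pseries_majorant_ex b g r hgb); lra.
  - intros N; rewrite (sum_n_ext _ (fun k => Cmod (comp p (shift o) b k) * r ^ k))
      by (intros k; now rewrite Hab).
    exact (comp_majorant r _ _ Hr SS N Phi p b SP).
Qed.
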